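(* Let $A \in \mathbb{R}^{n\times n}$. The following statements are equivalent: (i) the linear mapping $\mathcal{A}: \mathbb{R}^n \to \mathbb{R}^n$, $x \mapsto Ax$, is averaged; (ii) for every initial condition $x(0) \in \mathbb{R}^n$, the solution to the system $$x(k+1) = A\, x(k), \quad k \in \mathbb{N},$$ converges to some $\overline{x} \in \ker(I-A)$, i.e., to some fixed point of $\mathcal{A}$ (the limit $\overline{x}$ may depend on $x(0)$).
   Context: Norms $\|\cdot\|$ on $\mathbb{R}^n$ are Hilbert-space norms, i.e., induced by an inner product (equivalently, of the form $\|x\|_P = \sqrt{x^\top P x}$ with $P$ symmetric positive definite). For $\eta \in (0,1)$, a Lipschitz continuous mapping $\mathcal{T}:\mathbb{R}^n\to\mathbb{R}^n$ is $\eta$-averaged with respect to $\|\cdot\|$ if for all $x,y \in \mathbb{R}^n$ $$\|\mathcal{T}(x)-\mathcal{T}(y)\|^2 \le \|x-y\|^2 - \tfrac{1-\eta}{\eta} \,\|(\mathrm{Id}-\mathcal{T})(x) - (\mathrm{Id}-\mathcal{T})(y)\|^2 ,$$ or, equivalently, if $\mathcal{T} = (1-\eta)\mathrm{Id} + \eta \mathcal{B}$ for some mapping $\mathcal{B}$ that is nonexpansive (1-Lipschitz) with respect to $\|\cdot\|$. $\mathcal{T}$ is averaged if there exist $\eta \in (0,1)$ and a (Hilbert) norm $\|\cdot\|$ on $\mathbb{R}^n$ such that $\mathcal{T}$ is $\eta$-averaged with respect to $\|\cdot\|$. Here $\mathrm{Id}$ is the identity operator and $\ker(I-A)=\{x \in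 \mathbb{R}^n : x = Ax\}$. *)

(* Defs.v *)
From HB Require Import structures.
From mathcomp Require Import all_boot all_order all_algebra.
From mathcomp Require Import all_classical all_reals all_analysis.

Set Implicit Arguments.
Unset Strict Implicit.
Unset Printing Implicit Defensive.

Import Order.TTheory GRing.Theory Num.Theory.
Import numFieldNormedType.Exports.

Local Open Scope classical_set_scope.
Local Open Scope ring_scope.

(* R^n is ['cV[R]_n].  Its canonical MathComp-Analysis norm [`|x|] is the sup  *)
(* norm; it is used here only for its topology and for Lipschitz continuity,   *)
(* which do not depend on the norm chosen.  With [theta := idfun],             *)
(* [{dot V for idfun}] is the type of symmetric positive definite bilinear     *)
(* forms on V, that is, of real inner products.                                *)

Definition hilbert_norm (R : realType) (n : nat)
    (ip : {dot 'cV[R]_n for idfun}) (x : 'cV[R]_n) : R :=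
  Num.sqrt (ip x x).

Definition averaged_with (R : realType) (n : nat)
    (ip : {dot 'cV[R]_n for idfun}) (eta : R) (T : 'cV[R]_n -> 'cV[R]_n) : Prop :=
  (lipschitz T) /\
  forall x y : 'cV[R]_n,
    hilbert_norm ip (T x - T y) ^+ 2 <=
      hilbert_norm ip (x - y) ^+ 2
      - (1 - eta) / eta * hilbert_norm ip ((x - T x) - (y - T y)) ^+ 2.

Definition averaged (R : realType) (n : nat) (T : 'cV[R]_n -> 'cV[R]_n) : Prop :=
  exists (eta : R) (ip : {dot 'cV[R]_n for idfun}),
    [/\ 0 < eta, eta < 1 & averaged_with ip eta T].

Definition is_solution (R : realType) (n : nat) (A : 'M[R]_n) (x0 : 'cV[R]_n)
    (x : nat -> 'cV[R]_n) : Prop :=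
  x 0%N = x0 /\ forall k : nat, x k.+1 = A *m x k.

(* ker (I - A); MathComp's [kermx] is the kernel for row vectors. *)
Definition fixed_space (R : realType) (n : nat) (A : 'M[R]_n) : set 'cV[R]_n :=
  [set x | x = A *m x].

(* Main.v *)
Require Import Defs.
From HB Require Import structures.
From mathcomp Require Import all_boot all_order all_algebra.
From mathcomp Require Import all_classical all_reals all_analysis.
From mathcomp Require Import ring lra.

Set Implicit Arguments.
Unset Strict Implicit.
Unset Printing Implicit Defensive.

Import Order.TTheory GRing.Theory Num.Theory.
Import numFieldNormedType.Exports.

Local Open Scope classical_set_scope.
Local Open Scope ring_scope.

(* If [A] is averaged for a norm with square [q], then [q] decreases along the
   orbits by at least [c * q (x - A x)], so [A ^ k (y - A y) --> 0] for all [y].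
   Hence [ker (I - A)] and [im (I - A)] meet only in 0 and span the space, and
   [A ^ k] sends [u + (w - A w)], with [A u = u], towards [u].
   Conversely, let [P] be the limit of [A ^ k] and [Q := I - P].  For [m] such
   that [|A ^ (m + 1) Q|^2 <= 1/2], the norm with square
   [|P x|^2 + \sum_(k <= m) |A ^ k Q x|^2] telescopes: applying [A] decreases it
   by at least [|Q x|^2 / 2], which dominates the square of
   [x - A x = (I - A) Q x]. *)

(** * Convergence and Lipschitz continuity for matrices *)

Lemma cvg_mxP (R : realType) m n (u : nat -> 'M[R]_(m, n)) (l : 'M[R]_(m, n)) :
  u @ \oo --> l <-> forall i j, (fun k => u k i j) @ \oo --> l i j.
Proof.
split=> [ul i j|ul].
  apply: (@continuous_cvg nat 'M[R]_(m, n) R \oo _ u (fun M => M i j) l _ ul).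
  exact: coord_continuous.
apply/cvgrPdist_le => /= e e0; near=> k.
rewrite [leLHS]/Num.Def.normr/= mx_normrE (bigmax_le _ (ltW e0))//= => i _.
rewrite !mxE; move: i; near: k; apply: filter_forall => /= i.
exact: ((cvgrPdist_le _ _).1 (ul i.1 i.2)).
Unshelve. all: by end_near. Qed.

Lemma cvg_mulmx (R : realType) m n p (u : nat -> 'M[R]_(m, n))
    (v : nat -> 'M[R]_(n, p)) (U : 'M[R]_(m, n))
    (V : 'M[R]_(n, p)) :
  u @ \oo --> U -> v @ \oo --> V -> (fun k => u k *m v k) @ \oo --> U *m V.
Proof.
move=> /cvg_mxP uU /cvg_mxP vV; apply/cvg_mxP => i j.
rewrite mxE; under eq_fun do rewrite mxE.
apply: cvg_big => [|k _]; first exact: add_continuous.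
by apply: cvgM.
Qed.

Lemma lipschitz_mulmx (R : realType) n (A : 'M[R]_n) :
  lipschitz (fun x : 'cV[R]_n => A *m x).
Proof.
(* [C] dominates every row sum of absolute values, hence the operator norm for the sup norm. *)
pose C := \sum_i \sum_j `|A i j|.
have C0 : 0 <= C by do 2 (apply: sumr_ge0 => ? _).
apply: (@klipschitzW _ _ _ C); first exact: (@globally_properfilter _ _ (0, 0)).
move=> -[x y] _ /=; rewrite -mulmxBr.
set z := x - y.
rewrite [leLHS]/Num.Def.normr/= mx_normrE bigmax_le ?mulr_ge0//= => -[i j] _ /=.
rewrite mxE (le_trans (ler_norm_sum _ _ _))//.
rewrite [C](bigD1 i) //= mulrDl ler_wpDr ?mulr_ge0 //.
  by do 2 (apply: sumr_ge0 => ? _).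
rewrite mulr_suml; apply: ler_sum => k _; rewrite normrM ler_wpM2l//.
rewrite [leRHS]/Num.Def.normr/= mx_normrE.
exact: (le_bigmax _ (fun ij => `|z ij.1 ij.2|) (k, j)).
Qed.

(** * Inner products on R^n *)

Lemma dot_ge0 (R : realType) n (ip : {dot 'cV[R]_n for idfun}) x : 0 <= ip x x.
Proof.
by have [->|x0] := eqVneq x 0; rewrite ?linear0r// ltW// neq0_dnorm_gt0.
Qed.

Lemma hilbert_norm_sqr (R : realType) n (ip : {dot 'cV[R]_n for idfun}) x :
  hilbert_norm ip x ^+ 2 = ip x x.
Proof. by rewrite sqr_sqrtr// dot_ge0. Qed.

Lemma dotC (R : realType) n (ip : {dot 'cV[R]_n for idfun}) x y :
  ip x y = ip y x.
Proof. by rewrite hermitian_subproof expr0 mul1r. Qed.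

Lemma dotBl (R : realType) n (ip : {dot 'cV[R]_n for idfun}) a b x x' y :
  ip (a *: x - b *: x') y = a * ip x y - b * ip x' y.
Proof. by rewrite linearBl linearZl_LR [X in _ - X]linearZl_LR. Qed.

Lemma dot_sqrB (R : realType) n (ip : {dot 'cV[R]_n for idfun}) a b x y :
  ip (a *: x - b *: y) (a *: x - b *: y) =
  a ^+ 2 * ip x x - 2 * a * b * ip x y + b ^+ 2 * ip y y.
Proof.
by rewrite dotBl !(dotC ip _ (_ - _)) !dotBl (dotC ip y x); ring.
Qed.

Lemma dot_CauchySchwarz (R : realType) n (ip : {dot 'cV[R]_n for idfun}) x y :
  ip x y ^+ 2 <= ip x x * ip y y.
Proof.
have [->|y0] := eqVneq y 0; first by rewrite (linear0r ip x) expr0n (linear0r ip 0) mulr0.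
have qy : 0 < ip y y by rewrite neq0_dnorm_gt0.
(* The square of this vector is [ip y y] times [ip x x * ip y y - ip x y ^+ 2]. *)
have := dot_ge0 ip (ip y y *: x - ip x y *: y).
rewrite dot_sqrB => h; rewrite -subr_ge0 -(pmulr_rge0 _ qy).
by apply: le_trans h _; rewrite le_eqVlt; apply/orP; left; apply/eqP; ring.
Qed.

(** A sum of pullbacks of the Euclidean inner product is positive semidefinite; the trivial common
    kernel makes it definite. *)
Lemma gram_dot (R : realType) n m (N : nat -> 'M[R]_n) :
  (forall x : 'cV_n, (forall k, (k < m)%N -> N k *m x = 0) -> x = 0) ->
  exists ip : {dot 'cV[R]_n for idfun},
    forall x y, ip x y = \sum_(k < m) ((N k *m x)^T *m (N k *m y)) 0 0.
Proof.
move=> Ninj.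
pose f (x y : 'cV[R]_n) : R := \sum_(k < m) ((N k *m x)^T *m (N k *m y)) 0 0.
have fC x y : f x y = f y x.
  by apply: eq_bigr => k _; rewrite !mxE; apply: eq_bigr => i _; rewrite !mxE mulrC.
have fl y : GRing.linear_for *%R (f ^~ y).
  move=> a x x'; rewrite /f mulr_sumr -big_split; apply: eq_bigr => k _ /=.
  by rewrite mulmxDr -scalemxAr linearD linearZ /= mulmxDl -scalemxAl !mxE.
have fpos x : x != 0 -> 0 < f x x.
  have sq k : ((N k *m x)^T *m (N k *m x)) 0 0 = \sum_i (N k *m x) i 0 ^+ 2.
    by rewrite mxE; apply: eq_bigr => i _; rewrite mxE expr2.
  have f0 (k : 'I_m) : true -> 0 <= ((N k *m x)^T *m (N k *m x)) 0 0.
    by rewrite sq sumr_ge0// => i _; rewrite sqr_ge0.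
  apply: contraNT; rewrite -leNgt => fx; apply/eqP/Ninj => k km.
  have fx0 : f x x = 0 by apply/le_anti; rewrite fx sumr_ge0.
  have := psumr_eq0P f0 fx0 (i := Ordinal km) isT; rewrite sq => Nx0.
  apply/matrixP => i j; rewrite ord1 [RHS]mxE; apply/eqP; rewrite -sqrf_eq0.
  by rewrite (psumr_eq0P _ Nx0)// => ? _; rewrite sqr_ge0.
have fr y : GRing.linear_for (idfun \; *%R) (f y).
  by move=> a x x'; rewrite fC fl !(fC y).
pose fB := bilinear_isBilinear.Build R _ _ _
  (GRing.Scale.Law.clone _ _ *%R _) (GRing.Scale.Law.clone _ _ (idfun \; *%R) _)
  f (fl, fr).
pose fH := isHermitianSesquilinear.Build R _ false idfun f
  (fun x y => etrans (fC x y) (esym (mul1r _))).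
pose fD := isDotProduct.Build R _ f fpos.
pose ip : {dot 'cV[R]_n for idfun} := HB.pack f fB fH fD.
by exists ip.
Qed.

Lemma dot_sumE (R : realType) n (ip : {dot 'cV[R]_n for idfun})
    (x y : 'cV[R]_n) :
  ip x y = \sum_j ip x (delta_mx j 0) * y j 0.
Proof.
rewrite {1}(matrix_sum_delta y) linear_sum; apply: eq_bigr => j _ /=.
by rewrite big_ord1 linearZr_LR /= mulrC.
Qed.

(* The Gram matrix of [ip] is invertible, so each coordinate is [ip]-dual to a
   vector, and Cauchy-Schwarz applies. *)
Lemma dot_coord_bound (R : realType) n (ip : {dot 'cV[R]_n for idfun}) :
  exists C : R, forall (x : 'cV[R]_n) i, x i 0 ^+ 2 <= C * ip x x.
Proof.
pose G : 'M[R]_n := \matrix_(i, j) ip (delta_mx i 0) (delta_mx j 0).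
have GE (v : 'rV_n) j : ip v^T (delta_mx j 0) = (v *m G) 0 j.
  rewrite dotC dot_sumE mxE; apply: eq_bigr => i _.
  by rewrite !mxE mulrC dotC.
have Gu : G \in unitmx.
  rewrite -row_free_unit; apply: inj_row_free => v vG.
  apply: trmx_inj; rewrite trmx0; apply/eqP; apply: contraT.
  move=> /(neq0_dnorm_gt0 (s:=ip)); rewrite dot_sumE big1 ?ltxx// => j _.
  by rewrite GE vG mxE mul0r.
pose g i := (row i (invmx G))^T.
have gE i x : ip (g i) x = x i 0.
  rewrite dot_sumE (bigD1 i) //= big1 ?addr0 => [|j ji];
    by rewrite GE -row_mul mulVmx// !mxE ?eqxx ?mul1r// eq_sym (negbTE ji) mul0r.
exists (\sum_i ip (g i) (g i)) => x i; rewrite -gE.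
apply: le_trans (dot_CauchySchwarz _ _ _) _; rewrite ler_wpM2r ?dot_ge0//.
by rewrite (bigD1 i) //= lerDl sumr_ge0// => j _; rewrite dot_ge0.
Qed.

(** [dot_coord_bound] squeezes every squared coordinate to 0, and the square root is continuous at
    0. *)
Lemma dot_cvg0 (R : realType) n (ip : {dot 'cV[R]_n for idfun})
    (u : nat -> 'cV[R]_n) :
  (fun k => ip (u k) (u k)) @ \oo --> (0 : R) -> u @ \oo --> (0 : 'cV[R]_n).
Proof.
move=> u0; have [C bC] := dot_coord_bound ip.
apply/cvg_mxP => i j; rewrite ord1 mxE.
apply: norm_cvg0.
rewrite (_ : (fun _ => _) = fun k => Num.sqrt (u k i 0 ^+ 2)); last first.
  by apply/funext => k; rewrite sqrtr_sqr.
rewrite -sqrtr0; apply: (continuous_cvg _ (@sqrt_continuous R 0)).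
apply: (@squeeze_cvgr _ _ _ _ (cst 0) (fun k => C * ip (u k) (u k))).
- by near=> k; rewrite sqr_ge0 bC.
- exact: cvg_cst.
- by rewrite -(mulr0 C); apply: cvgM u0; exact: cvg_cst.
Unshelve. all: by end_near. Qed.

(** * From averaged maps to convergent orbits *)

(** The image and the kernel of [B] meet only in 0, so [B *m B] has the rank of [B] and
    [B = B *m B *m D^T] for some [D]; then [w := D^T *m x] works. The transpose turns column spaces
    into the row spaces of [mxalgebra]. *)
Lemma ker_im_decomp (F : fieldType) n (B : 'M[F]_n) :
  (forall y : 'cV[F]_n, B *m (B *m y) = 0 -> B *m y = 0) ->
  forall x : 'cV[F]_n, exists w, B *m (x - B *m w) = 0.
Proof.
move=> kerB x; pose C := B^T.
have C0 : (C :&: kermx C)%MS = 0.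
  apply/eqP; rewrite -submx0; apply/rV_subP => v.
  rewrite sub_capmx => /andP[/submxP[s ->] /sub_kermxP sCC].
  have : B *m (B *m s^T) = 0.
    by apply: trmx_inj; rewrite !trmx_mul trmxK trmx0.
  by move=> /kerB Bs; rewrite -[s]trmxK -trmx_mul Bs trmx0 sub0mx.
have /submxP[D CD] : (C <= C *m C)%MS.
  rewrite -(geq_leqif (mxrank_leqif_sup (submxMl C C))).
  by rewrite -(mxrank_mul_ker C C) C0 mxrank0 addn0.
have BD : B = B *m B *m D^T by apply: trmx_inj; rewrite !trmx_mul trmxK -/C.
by exists (D^T *m x); rewrite mulmxBr {1}BD !mulmxA subrr.
Qed.

Lemma dot_descent_cvg (R : realType) n (ip : {dot 'cV[R]_n for idfun}) (c : R)
    (A : 'M[R]_n) :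
  0 < c ->
  (forall x : 'cV[R]_n,
     ip (A *m x) (A *m x) <= ip x x - c * ip (x - A *m x) (x - A *m x)) ->
  forall x : 'cV[R]_n,
    exists u, u = A *m u /\ (fun k => A ^+ k *m x) @ \oo --> u.
Proof.
move=> c0 descent x.
have AS k (y : 'cV_n) : A ^+ k.+1 *m y = A *m (A ^+ k *m y).
  by rewrite exprS mulmxA.
have AB k (y : 'cV_n) : A ^+ k *m (y - A *m y) = A ^+ k *m y - A ^+ k.+1 *m y.
  by rewrite mulmxBr mulmxA exprSr.
have d0 (y : 'cV[R]_n) :
      (fun k => A ^+ k *m (y - A *m y)) @ \oo --> (0 : 'cV[R]_n).
  apply: (@dot_cvg0 _ _ ip).
  pose d k := ip (A ^+ k *m (y - A *m y)) (A ^+ k *m (y - A *m y)).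
  have dS k : d k.+1 <= d k.
    rewrite /d AS; apply: le_trans (descent _) _.
    by rewrite gerBl mulr_ge0 ?dot_ge0// ltW.
  (* The drops of [ip] along the orbit telescope, and each of the first [k.+1] is at least [c * d k]
     since [d] is nonincreasing. Hence [d] decays at a harmonic rate. *)
  have dk k : k.+1%:R * (c * d k) <= ip y y - ip (A ^+ k.+1 *m y) (A ^+ k.+1 *m y).
    elim: k => [|k IH].
      rewrite mul1r /d expr0 expr1 !mul1mx; have := descent y; lra.
    have := descent (A ^+ k.+1 *m y); rewrite -AS -AB -/(d k.+1) => h.
    have : k.+1%:R * (c * d k.+1) <= k.+1%:R * (c * d k).
      by rewrite ler_wpM2l// ler_wpM2l// ltW.
    rewrite [k.+2%:R]mulrSr; lra.
  apply: (@squeeze_cvgr _ _ _ _ (cst 0) (fun k => c^-1 * ip y y * harmonic k)).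
  - near=> k; rewrite dot_ge0 /harmonic/= -/(d k) ler_pdivlMr// mulrC.
    rewrite ler_pdivlMl// mulrCA; apply: le_trans (dk k) _.
    by rewrite gerBl dot_ge0.
  - exact: cvg_cst.
  - rewrite -(mulr0 (c^-1 * ip y y)).
    by apply: cvgM cvg_harmonic; exact: cvg_cst.
pose B := 1%:M - A.
have BE (y : 'cV_n) : B *m y = y - A *m y by rewrite mulmxBl mul1mx.
have [y By|w] := @ker_im_decomp _ _ B _ x.
  (* [A] fixes [z], so [A ^+ k *m z] is constant, yet it tends to 0 by [d0]; hence [z = 0]. *)
  set z := B *m y; have Az : A *m z = z.
    by apply/esym/eqP; rewrite -subr_eq0 -BE By.
  have zk k : A ^+ k *m z = z.
    by elim: k => [|k IH]; rewrite ?mul1mx// AS IH.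
  have : cst z @ \oo --> (0 : 'cV_n).
    rewrite (_ : cst z = fun k => A ^+ k *m (y - A *m y)) //.
    by apply/funext => k; rewrite -BE zk.
  by move=> z0; exact: norm_cvg_unique (cvg_cst z) z0.
rewrite BE => /subr0_eq; set u := x - B *m w => uA; exists u; split=> //.
have uk k : A ^+ k *m u = u.
  by elim: k => [|k IH]; rewrite ?mul1mx// AS IH -uA.
rewrite (_ : (fun _ => _) = fun k => u + A ^+ k *m (w - A *m w)).
  by rewrite -[X in _ --> X]addr0; apply: cvgD (cvg_cst _) (d0 w).
by apply/funext => k; rewrite -BE -{1}(uk k) -mulmxDr subrK.
Unshelve. all: by end_near. Qed.

(** * From convergent orbits to averaged maps *)

Definition frobenius_sqr (R : realType) m n (M : 'M[R]_(m, n)) : R :=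
  \sum_i \sum_j M i j ^+ 2.

Lemma frobenius_sqr_ge0 (R : realType) m n (M : 'M[R]_(m, n)) :
  0 <= frobenius_sqr M.
Proof. by do 2 (apply: sumr_ge0 => ? _); rewrite sqr_ge0. Qed.

Lemma frobenius_sqr_cV (R : realType) n (x : 'cV[R]_n) :
  frobenius_sqr x = (x^T *m x) 0 0.
Proof.
by rewrite mxE; apply: eq_bigr => i _; rewrite big_ord1 mxE expr2.
Qed.

(** Cauchy-Schwarz for each row of [M] against [x], summed over the rows. *)
Lemma frobenius_sqr_mulmx (R : realType) m n (M : 'M[R]_(m, n)) (x : 'cV[R]_n) :
  frobenius_sqr (M *m x) <= frobenius_sqr M * frobenius_sqr x.
Proof.
(* The single map [1%:M] gives the Euclidean inner product. *)
have [x0 h|ip ipE] := @gram_dot R n 1 (fun=> 1%:M).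
  by have := h 0%N isT; rewrite mul1mx.
have {}ipE y z : ip y z = (y^T *m z) 0 0 by rewrite ipE big_ord1 !mul1mx.
rewrite [frobenius_sqr M]/frobenius_sqr mulr_suml; apply: ler_sum => i _.
rewrite big_ord1.
have -> : (M *m x) i 0 = ip (row i M)^T x.
  by rewrite ipE trmxK -row_mul [RHS]mxE.
apply: le_trans (dot_CauchySchwarz _ _ _) _.
rewrite !ipE -!frobenius_sqr_cV ler_wpM2r ?frobenius_sqr_ge0// le_eqVlt.
by apply/orP; left; apply/eqP; apply: eq_bigr => j _; rewrite big_ord1 !mxE.
Qed.

Lemma cvg_frobenius_sqr (R : realType) m n (u : nat -> 'M[R]_(m, n))
    (l : 'M[R]_(m, n)) :
  u @ \oo --> l -> (fun k => frobenius_sqr (u k)) @ \oo --> frobenius_sqr l.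
Proof.
move=> /cvg_mxP ul.
do 2 (apply: cvg_big => [|? _]; first exact: add_continuous).
by rewrite expr2; under eq_fun do rewrite expr2; apply: cvgM.
Qed.

(** The columns of [P] are the limits of the orbits of the basis vectors. *)
Lemma cvg_powers (R : realType) n (A : 'M[R]_n) :
  (forall x : 'cV[R]_n,
     exists u, u = A *m u /\ (fun k => A ^+ k *m x) @ \oo --> u) ->
  exists P, A *m P = P /\ (fun k => A ^+ k) @ \oo --> P.
Proof.
move=> H; have [p pP] := choice (fun j : 'I_n => H (delta_mx j 0)).
exists (\matrix_(i, j) p j i 0); split.
  apply/matrixP => i j; have [/(congr1 (fun v : 'cV_n => v i 0)) e _] := pP j.
  by rewrite [RHS]mxE e !mxE; apply: eq_bigr => k _; rewrite mxE.
apply/cvg_mxP => i j; have [_ /cvg_mxP/(_ i 0)] := pP j.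
by rewrite mxE; under eq_fun do rewrite -colE mxE.
Qed.

Lemma descent_of_cvg_powers (R : realType) n (A P : 'M[R]_n) :
  A *m P = P -> (fun k => A ^+ k) @ \oo --> P ->
  exists (ip : {dot 'cV[R]_n for idfun}) (c : R), 0 < c /\
    forall x : 'cV[R]_n,
      ip (A *m x) (A *m x) <= ip x x - c * ip (x - A *m x) (x - A *m x).
Proof.
move=> AP AkP.
have AkPE k : A ^+ k *m P = P.
  by elim: k => [|k IH]; rewrite ?mul1mx// exprSr -mulmxA AP.
(* The constant sequence [A ^+ k *m P] also tends to [P *m P]. *)
have PP : P *m P = P.
  have h : (fun k => A ^+ k *m P) @ \oo --> P *m P.
    by apply: cvg_mulmx AkP _; exact: cvg_cst.
  apply: (norm_cvg_unique h).
  rewrite /= (_ : (fun _ => _) = cst P); first exact: cvg_cst.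
  by apply/funext => k; rewrite AkPE.
(* [A ^+ k *m A] is the shifted sequence of powers, so it still tends to [P]. *)
have PA : P *m A = P.
  have h : (fun k => A ^+ k *m A) @ \oo --> P *m A.
    by apply: cvg_mulmx AkP _; exact: cvg_cst.
  apply: (norm_cvg_unique h).
  rewrite /= (_ : (fun _ => _) = fun k => A ^+ k.+1).
    by have := AkP; rewrite -cvg_shiftS.
  by apply/funext => k; rewrite exprSr.
pose Q := 1%:M - P.
have PQ : P *m Q = 0 by rewrite mulmxBr mulmx1 PP subrr.
have QQ : Q *m Q = Q by rewrite {1}/Q mulmxBl mul1mx PQ subr0.
have QA : Q *m A = A *m Q by rewrite mulmxBl mulmxBr mul1mx mulmx1 PA AP.
have AkQ k : A ^+ k *m Q = A ^+ k - P by rewrite mulmxBr mulmx1 AkPE.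
(* [A ^+ k *m Q] tends to [P *m Q = 0]. *)
have [m mlt] : exists m, frobenius_sqr (A ^+ m.+1 *m Q) <= 2^-1.
  have : (fun k => frobenius_sqr (A ^+ k *m Q)) @ \oo --> (0 : R).
    have -> : 0 = frobenius_sqr (P *m Q).
      rewrite PQ /frobenius_sqr big1// => i _.
      by rewrite big1// => j _; rewrite mxE expr0n.
    by apply: cvg_frobenius_sqr; apply: cvg_mulmx AkP (cvg_cst Q).
  move=> /cvgrPdist_le /(_ 2^-1 ltac:(by rewrite invr_gt0)).
  move=> [m _ /(_ m.+1 (leqnSn m))] /=.
  by rewrite sub0r normrN ger0_norm ?frobenius_sqr_ge0//; exists m.
(* The index is shifted by one: [P] comes first, then [A ^+ k *m Q] for [k <= m], so there are
   [m.+2] maps. *)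
pose N k := if k is k'.+1 then A ^+ k' *m Q else P.
have [x Nx|ip ipE] := @gram_dot R n m.+2 N.
  (* The first two maps, [P] and [Q], already have trivial common kernel, as they sum to the
     identity. *)
  have := Nx 0%N isT; have := Nx 1%N isT.
  by rewrite /N /= !mul1mx mulmxBl mul1mx => /[swap] ->; rewrite subr0.
have {}ipE x : ip x x = frobenius_sqr (P *m x) +
    \sum_(k < m.+1) frobenius_sqr (A ^+ k *m (Q *m x)).
  rewrite ipE big_ord_recl /= -frobenius_sqr_cV; congr (_ + _).
  by apply: eq_bigr => k _; rewrite -frobenius_sqr_cV -mulmxA.
(* The sum bounds [ip] at [(1%:M - A) *m v] relative to [frobenius_sqr v]; the added 1 keeps [K]
   positive. *)
pose K := 1 + \sum_(k < m.+1) frobenius_sqr (A ^+ k *m Q *m (1%:M - A)).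
have K0 : 0 < K.
  by rewrite ltr_pwDl// sumr_ge0// => k _; rewrite frobenius_sqr_ge0.
exists ip, (2 * K)^-1; split=> [|x]; first by rewrite invr_gt0 mulr_gt0.
set v := Q *m x.
(* [P *m A = P] preserves the first term, and [A] shifts the sum: the term of index 0 leaves and
   that of index [m.+1] enters. *)
have descent : ip (A *m x) (A *m x) =
    ip x x - frobenius_sqr v + frobenius_sqr (A ^+ m.+1 *m v).
  rewrite !ipE !mulmxA PA QA -!mulmxA -/v big_ord_recr [in RHS]big_ord_recl /=.
  under [in RHS]eq_bigr do rewrite /bump /= add1n exprSr -mulmxA.
  rewrite mul1mx exprSr -mulmxA; lra.
have vm : frobenius_sqr (A ^+ m.+1 *m v) <= 2^-1 * frobenius_sqr v.
  (* Idempotence supplies a second [Q], so that the bound on [A ^+ m.+1 *m Q] applies to [v]. *)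
  rewrite /v -{1}QQ -(mulmxA Q) mulmxA.
  apply: le_trans (frobenius_sqr_mulmx _ _) _.
  by rewrite ler_wpM2r// frobenius_sqr_ge0.
have vK : ip (x - A *m x) (x - A *m x) <= K * frobenius_sqr v.
  have xE : x - A *m x = (1%:M - A) *m v.
    have BQ : (1%:M - A) *m Q = 1%:M - A.
      by rewrite mulmxBr mulmx1 [(_ - _) *m P]mulmxBl mul1mx AP subrr subr0.
    by rewrite /v mulmxA BQ mulmxBl mul1mx.
  rewrite ipE.
  have -> : P *m (x - A *m x) = 0 by rewrite mulmxBr mulmxA PA subrr.
  rewrite {1}/frobenius_sqr big1 ?add0r => [|i _]; last first.
    by rewrite big1// => j _; rewrite mxE expr0n.
  rewrite /K mulrDl mul1r ler_wpDl ?frobenius_sqr_ge0// mulr_suml.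
  apply: ler_sum => k _.
  by rewrite xE !mulmxA -!(mulmxA _ Q x) frobenius_sqr_mulmx.
(* By [vm] the decrease is at least half of [frobenius_sqr v]; the constant [(2 * K)^-1] keeps the
   subtracted term below that half. *)
rewrite descent -addrA lerD2l.
have : (2 * K)^-1 * ip (x - A *m x) (x - A *m x) <= 2^-1 * frobenius_sqr v.
  by rewrite invfM -mulrA ler_wpM2l ?invr_ge0// ler_pdivrMl.
lra.
Qed.

Theorem proposition1 (R : realType) (n : nat) (A : 'M[R]_n) :
  averaged (fun x : 'cV[R]_n => A *m x) <->
  (forall (x0 : 'cV[R]_n) (x : nat -> 'cV[R]_n), is_solution A x0 x ->
     exists xbar : 'cV[R]_n, fixed_space A xbar /\ x @ \oo --> xbar).
Proof.
split=> [[eta [ip [eta0 eta1 [_ avg]]]] x0 x [_ xS]|H].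
  have c0 : 0 < (1 - eta) / eta by rewrite divr_gt0// subr_gt0.
  have descent (y : 'cV[R]_n) : ip (A *m y) (A *m y) <=
      ip y y - (1 - eta) / eta * ip (y - A *m y) (y - A *m y).
    (* Compare with the fixed point 0. *)
    by have := avg y 0; rewrite mulmx0 !subr0 !hilbert_norm_sqr.
  have [u [uA xu]] := dot_descent_cvg c0 descent (x 0%N).
  exists u; split=> //; rewrite (_ : x = fun k => A ^+ k *m x 0%N)//.
  apply/funext; elim=> [|k IH]; first by rewrite mul1mx.
  by rewrite xS IH exprS mulmxA.
have [y|P [AP AkP]] := @cvg_powers _ _ A.
  apply: (H y); split; first by rewrite mul1mx.
  by move=> k; rewrite exprS mulmxA.
have [ip [c [c0 descent]]] := descent_of_cvg_powers AP AkP.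
have c1 : 0 < 1 + c by rewrite addr_gt0.
(* This is the solution [eta] of [(1 - eta) / eta = c]; by linearity, averagedness at [x], [y] is
   the descent at [x - y]. *)
exists (1 + c)^-1, ip; split; first by rewrite invr_gt0.
  by rewrite invf_lt1// ltrDl.
split=> [|x y]; first exact: lipschitz_mulmx.
have -> : x - A *m x - (y - A *m y) = x - y - A *m (x - y).
  by rewrite mulmxBr !opprD !opprK addrACA -!addrA.
have -> : (1 - (1 + c)^-1) / (1 + c)^-1 = c.
  by rewrite invrK mulrBl mul1r mulVf ?gt_eqF// addrC addKr.
by rewrite !hilbert_norm_sqr -mulmxBr.
Qed.
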